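(* Let $p\ge3$, let $\mathcal C_{p-1}$ be a Siebeck--Marden curve of class $p-1$ with real foci $a_1,\dots,a_{p-1}\in\mathbb C$, and let $\mathcal P$ be the family of $p$-gons inscribed in the unit circle $\mathbb T=\{z\in\mathbb C:|z|=1\}$ and circumscribed about $\mathcal C_{p-1}$. Then the sum of the squares of the lengths of all sides and diagonals of a polygon $P\in\mathcal P$ (that is, $\sum_{1\le j<k\le p}|z_j-z_k|^2$, where $z_1,\dots,z_p$ are the vertices of $P$) is invariant throughout $\mathcal P$ if and only if the circumcenter of $P$ coincides either with a focus of $\mathcal C_{p-1}$ or with the centroid $\frac{1}{p-1}(a_1+\cdots+a_{p-1})$ of the foci.
   Context: The plane is identified with $\mathbb C$. Given distinct points $z_1,\dots,z_p$ on a circle, $z_j=x_j+iy_j$, and nonzero reals $m_1,\dots,m_p$ with $\sum_j m_j\neq0$, the associated Siebeck--Marden curve $C(z_1,\dots,z_p;m_1,\dots,m_p)$ is the algebraic curve of class $p-1$ which touches each of the $p(p-1)/2$ lines $z_jz_k$ at the point dividing the segment from $z_j$ to $z_k$ in the ratio $m_j:m_k$; explicitly, the line $ux+vy+w=0$ is tangent to it iff $\sum_{j=1}^p m_j\prod_{k\ne j}(ux_k+vy_k+w)=0$. By the Siebeck--Marden theorem its real foci are the $p-1$ zeros (with multiplicity) of $\sum_{j=1}^p\frac{m_j}{z-z_j}$. A $p$-gon inscribed in $\mathbb T$ is circumscribed about a Siebeck--Marden curve $\mathcal C_{p-1}$ if its vertices $z_1,\dots,z_p\in\mathbb T$ are distinct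 and $\mathcal C_{p-1}=C(z_1,\dots,z_p;m_1,\dots,m_p)$ for some such weights $m_j$; $\mathcal P$ is the family of all such $p$-gons for the fixed curve $\mathcal C_{p-1}$. The circumcenter is the origin. *)

(* Defs.v *)
From HB Require Import structures.
From mathcomp Require Import all_boot all_order all_algebra.
From mathcomp Require Import reals complex mpoly.
Set Implicit Arguments.
Unset Strict Implicit.
Unset Printing Implicit Defensive.
Import Order.TTheory GRing.Theory Num.Theory.
Local Open Scope ring_scope.

(* An algebraic plane curve is given by its tangential (line) equation: a
   ternary form F(u, v, w), with 'X_0 = u, 'X_1 = v, 'X_2 = w, whose zeros are
   the tangent lines u x + v y + w = 0.  The degree of F is the class of the
   curve, and F is determined by the curve up to a nonzero factor. *)
Definition same_curve (R : realType) (F G : {mpoly R[3]}) : Prop :=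
  exists2 c : R, c != 0 & F = c *: G.

Definition point_form (R : realType) (z : R[i]) : {mpoly R[3]} :=
  complex.Re z *: 'X_0 + complex.Im z *: 'X_1 + 'X_2.

Definition siebeck_marden_form (R : realType) (p : nat)
    (z : 'I_p -> R[i]) (m : 'I_p -> R) : {mpoly R[3]} :=
  \sum_(j < p) m j *: \prod_(k < p | k != j) point_form (z k).

Definition admissible_weights (R : realType) (p : nat) (m : 'I_p -> R) : Prop :=
  (forall j, m j != 0) /\ \sum_(j < p) m j != 0.

Definition on_circle (R : realType) (c : R[i]) (r : R) (p : nat)
    (z : 'I_p -> R[i]) : Prop :=
  forall j, `|z j - c| = r%:C%C.

Definition siebeck_marden_curve (R : realType) (p : nat) (F : {mpoly R[3]}) :
    Prop :=
  exists (c : R[i]) (r : R) (z : 'I_p -> R[i]) (m : 'I_p -> R),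
    [/\ 0 < r, on_circle c r z, injective z, admissible_weights m
      & same_curve F (siebeck_marden_form z m)].

(* A point a + i b is a real focus of a curve when the isotropic line
   (x - a) + i (y - b) = 0 through it is tangent to the curve, i.e. when
   F(1, i, - (a + i b)) = 0; the conjugate isotropic line is then tangent too,
   because F is real.  The focal polynomial is F(1, i, - 'X), and the
   multiplicity of a focus is its multiplicity as a root. *)
Definition focal_poly (R : realType) (F : {mpoly R[3]}) : {poly R[i]} :=
  mmap (polyC \o real_complex R)
    (fun i : 'I_3 => [:: 1; (0 +i* 1)%C%:P; - 'X]`_i) F.

Definition real_foci (R : realType) (n : nat) (F : {mpoly R[3]})
    (a : n.-tuple R[i]) : Prop :=
  exists2 c : R[i], c != 0 & focal_poly F = c *: \prod_(x <- a) ('X - x%:P).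

Definition centroid (R : realType) (n : nat) (a : n.-tuple R[i]) : R[i] :=
  n%:R^-1 * \sum_(x <- a) x.

(* The p-gons inscribed in the unit circle and circumscribed about F. *)
Definition poncelet_family (R : realType) (p : nat) (F : {mpoly R[3]})
    (z : 'I_p -> R[i]) : Prop :=
  [/\ injective z, on_circle 0 1 z
    & exists2 m : 'I_p -> R, admissible_weights m
        & same_curve F (siebeck_marden_form z m)].

Definition sum_sq_lengths (R : realType) (p : nat) (z : 'I_p -> R[i]) : R[i] :=
  \sum_(j < p) \sum_(k < p | (j < k)%N) `|z j - z k| ^+ 2.

(* Siebeck-Marden: the foci are the zeros of \sum_j m_j / (z - z_j). *)
Lemma focal_poly_siebeck_marden (R : realType) (p : nat)
    (z : 'I_p -> R[i]) (m : 'I_p -> R) :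
  focal_poly (siebeck_marden_form z m) = (-1) ^+ p.-1 *:
    \sum_(j < p) (m j)%:C%C *: \prod_(k < p | k != j) ('X - (z k)%:P).
Proof.
have Epf (w : R[i]) : focal_poly (point_form w) = - ('X - w%:P).
  rewrite /focal_poly /point_form !mmapD !mmapZ !mmapX !mmap1U /= mulr1 opprB.
  rewrite -polyCM -polyCD; congr (_%:P - 'X).
  case: w => x y; apply/eqP; rewrite eq_complex /=.
  by rewrite !(mulr0, mulr1, mul0r, subr0, addr0, add0r) !eqxx.
rewrite /focal_poly raddf_sum /= scaler_sumr; apply: eq_bigr => j _.
rewrite mmapZ rmorph_prod /= (eq_bigr (fun k => - ('X - (z k)%:P))); last first.
  by move=> k _; rewrite -Epf.
rewrite prodrN mul_polyC (@eq_card _ _ (predC1 j)) // cardC1 card_ord.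
have -> : (-1) ^+ p.-1 = ((-1) ^+ p.-1)%:P :> {poly R[i]}.
  by rewrite rmorphXn rmorphN1.
by rewrite mul_polyC !scalerA mulrC.
Qed.

(* Main.v *)
(* Write [f(X) = \sum_j m_j \prod_(k != j) (X - z_k) = M g(X)], where [g] is the
   monic polynomial whose roots are the foci, and [mu = \prod_k (- z_k)].  Since
   [1 / z_k] is the conjugate of [z_k], one has on the unit circle
   [\prod_k (x - z_k) = x g(x) + mu x^(p-1) (g(x))^*], hence
   [\sum_k z_k = \sum_i a_i - mu (\prod_i - a_i)^*], while the sum of the squared
   lengths is [p^2 - |\sum_k z_k|^2].  It is therefore constant if 0 is a focus or
   the centroid.  Conversely, in a rational parameter [t] of the circle the
   vertices are the roots of a real polynomial [P], the weights are encoded by a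
   polynomial [N], and the curve by the Bezoutian of [P] and [N].  Replacing [P]
   by [P - e N] with [e] small keeps [p] real roots and the Bezoutian, so it gives
   further polygons of the family.  They have different [mu]'s, and three values
   of [mu] suffice to conclude. *)

Require Import Defs.
From mathcomp Require Import all_boot all_order all_algebra.
From mathcomp Require Import reals complex mpoly.
From mathcomp Require Import polyrcf ring lra.
Import Order.TTheory GRing.Theory Num.Theory.
Local Open Scope ring_scope.

Set Implicit Arguments.
Unset Strict Implicit.
Unset Printing Implicit Defensive.

(** * Polynomials that vanish as functions *)

Lemma horner_eq0_poly (K : numDomainType) (p : {poly K}) :
  (forall x, p.[x] = 0) -> p = 0.
Proof.
move=> p0; apply/eqP; apply: contraT => pn0.
have := @max_poly_roots _ p [seq i%:R | i <- iota 0 (size p)] pn0.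
rewrite size_map size_iota ltnn => -> //.
  by apply/allP => x _; rewrite rootE p0.
by rewrite map_inj_uniq ?iota_uniq //; apply: mulrIn; rewrite oner_eq0.
Qed.

(** Induction on the number of variables: [muni] turns [p] into a univariate polynomial in the last
    variable. For fixed values of the others it vanishes identically, so each coefficient vanishes
    at every point. *)
Lemma meval_eq0_mpoly (K : numDomainType) (n : nat) (p : {mpoly K[n]}) :
  (forall v, p.@[v] = 0) -> p = 0.
Proof.
elim: n p => [|n IHn] p p0.
  apply/mpolyP => m; rewrite mcoeff0; have := p0 (fun _ => 0).
  rewrite mevalE (eq_bigr (fun m => p@_m)) => [|m' _]; last first.
    by rewrite big_ord0 mulr1.
  have Em (m' : 'X_{1..0}) : m' = m by apply/mnmP => -[].
  case: (boolP (m \in msupp p)) => [mp|/memN_msupp_eq0 -> //].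
  rewrite (bigD1_seq m) ?msupp_uniq //= big1 ?addr0 // => m'.
  by rewrite (Em m') eqxx.
have u0 : muni p = 0.
  apply/polyP => k; rewrite coef0; apply: IHn => v.
  rewrite -[LHS](coef_map (meval v)) /=.
  rewrite [map_poly _ _](_ : _ = 0) ?coef0 //; apply: horner_eq0_poly => x.
  have := p0 (fun i => if unlift ord_max i is Some j then v j else x).
  rewrite mevalE muniE raddf_sum horner_sum /= => {2}<-.
  apply: eq_bigr => m _.
  rewrite -mul_polyC rmorphM /= map_polyXn map_polyC /= hornerM hornerXn hornerC.
  rewrite mevalZ mevalX big_ord_recr /= unlift_none mulrA; congr (_ * _ * _).
  apply: eq_bigr => i _; rewrite mnmE; congr (_ ^+ m _).
  rewrite (_ : widen_ord _ i = lift ord_max i) ?liftK //; apply/val_inj.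
  by rewrite /= /bump leqNgt ltn_ord.
apply/mpolyP => m; rewrite mcoeff0.
have := congr1 (fun q : {poly {mpoly K[n]}} =>
  q`_(m ord_max)@_[multinom (m (widen_ord (leqnSn n) i)) | i < n]) u0.
rewrite coef0 mcoeff0 muniE coef_sum raddf_sum /=.
case: (boolP (m \in msupp p)) => [mp|/memN_msupp_eq0 -> //].
rewrite (bigD1_seq m) ?msupp_uniq //= coefZ coefXn eqxx mulr1 mcoeffZ mcoeffX eqxx.
rewrite mulr1 big1 ?addr0 // => m' m'm.
rewrite coefZ coefXn; case: eqP => [El|_]; last by rewrite mulr0 mcoeff0.
rewrite mulr1 mcoeffZ mcoeffX; case: eqP => [Ew|_]; last by rewrite mulr0.
case/eqP: m'm; apply/mnmP => i; case: (unliftP ord_max i) => [j ->|-> //].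
have := congr1 (fun q : 'X_{1..n} => q j) Ew; rewrite !mnmE.
rewrite (_ : widen_ord _ j = lift ord_max j) //; apply/val_inj.
by rewrite /= /bump leqNgt ltn_ord.
Qed.

(** * Perturbation of polynomials with simple real roots *)

Lemma horner_negative_near0 (K : rcfType) (I : finType) (r : I -> {poly K}) :
  (forall i, (r i).[0] < 0) ->
  exists2 d : K, 0 < d & forall (x : K) i, `|x| < d -> (r i).[x] < 0.
Proof.
move=> r0; pose P (s : seq I) := exists2 d : K, 0 < d &
  forall (x : K) i, i \in s -> `|x| < d -> (r i).[x] < 0.
suff: P (enum I).
  by case=> d d0 dP; exists d => // x i; apply: dP; rewrite mem_enum.
elim: (enum I) => [|i s [d d0 dP]]; first by exists 1.
have ri : 0 < - (r i).[0] by rewrite oppr_gt0.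
have [e e0 eP] := @poly_cont _ 0 (r i) _ ri.
exists (Num.min d e); first by rewrite lt_min d0.
move=> x j; rewrite inE lt_min => /orP[/eqP -> /andP[_ xe]|js /andP[xd _]];
    last exact: dP.
have := eP x; rewrite subr0 => /(_ xe); rewrite ltr_norml => /andP[_]; lra.
Qed.

Lemma injective_gap (K : realFieldType) (n : nat) (t : 'I_n -> K) :
  injective t ->
  exists2 d : K, 0 < d & forall j k, j != k -> d *+ 2 < `|t j - t k|.
Proof.
move=> tI; pose F (jk : 'I_n * 'I_n) := `|t jk.1 - t jk.2|.
suff [d d0 dP] : exists2 d : K, 0 < d &
    forall jk, jk \in enum {: 'I_n * 'I_n} -> jk.1 != jk.2 -> d *+ 2 < F jk.
  by exists d => // j k jk; apply: (dP (j, k)) => //; rewrite mem_enum.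
elim: (enum _) => [|jk s [d d0 dP]]; first by exists 1.
have [E|N] := eqVneq jk.1 jk.2.
  exists d => // jk'; rewrite inE => /orP[/eqP ->|]; first by rewrite E eqxx.
  exact: dP.
have F0 : 0 < F jk by rewrite normr_gt0 subr_eq0 (inj_eq tI).
exists (Num.min d (F jk / 3)).
  by rewrite lt_min d0 divr_gt0.
move=> jk'; rewrite inE => /orP[/eqP -> _|js N'].
  have : Num.min d (F jk / 3) <= F jk / 3 by rewrite ge_min lexx orbT.
  rewrite mulr2n; lra.
have := dP jk' js N'.
have : Num.min d (F jk / 3) <= d by rewrite ge_min lexx.
rewrite mulr2n; lra.
Qed.

(** At the ends of a small interval around each root, [P] takes values of opposite signs, and this
    persists for small [e]. The intermediate value theorem then gives a root of [P - e N] in each of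
    [n] disjoint intervals, and a monic polynomial of degree [n] has no others. *)
Lemma simple_real_roots_perturb (K : rcfType) (n : nat) (t : 'I_n -> K)
    (N : {poly K}) : injective t -> (size N <= n)%N ->
  exists2 d : K, 0 < d & forall e : K, `|e| < d ->
    exists2 t' : 'I_n -> K, injective t' &
    \prod_(k < n) ('X - (t k)%:P) - e *: N = \prod_(k < n) ('X - (t' k)%:P).
Proof.
move=> tI sN; set P := \prod_(k < n) _.
have [h h0 hP] := @injective_gap _ _ _ tI.
(* The value of [P - e N] at [a] as a polynomial in [e], so that continuity in [e] controls the sign
   of [r j], the product of the two endpoint values. *)
pose val (a : K) := P.[a]%:P - N.[a] *: 'X.
have valE a e : (val a).[e] = (P - e *: N).[a].
  by rewrite /val !hornerE mulrC.
pose r j := val (t j - h) * val (t j + h).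
have r0 j : (r j).[0] < 0.
  rewrite hornerM !valE scale0r subr0 /P !horner_prod -big_split /=.
  rewrite (bigD1 j) //= !hornerE pmulr_llt0.
    suff -> : (t j - h - t j) * (t j + h - t j) = - h ^+ 2 by rewrite oppr_lt0 exprn_gt0.
    by ring.
  apply: prodr_gt0 => k kj; rewrite !hornerE.
  have -> : (t j - h - t k) * (t j + h - t k) = (t j - t k) ^+ 2 - h ^+ 2 by ring.
  have := hP j k; rewrite eq_sym kj subr_gt0 => /(_ isT) H.
  rewrite -[X in _ < X]real_normK ?num_real // ltr_pXn2r ?nnegrE ?(ltW h0) //.
  by move: H; rewrite mulr2n; lra.
have [d d0 dP] := @horner_negative_near0 _ _ _ r0.
exists d => // e ed.
have root_near j : {x | x \in `](t j - h), (t j + h)[ & root (P - e *: N) x}.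
  apply: poly_ivtoo; first by lra.
  by rewrite -!valE -hornerM; apply: dP.
pose t' j := s2val (root_near j).
have t'P j : t' j \in `](t j - h), (t j + h)[ by exact: s2valP (root_near j).
have t'r j : root (P - e *: N) (t' j) by exact: s2valP' (root_near j).
have t'I : injective t'.
  move=> j k Ejk; apply/eqP; apply: contraT => /hP.
  have := t'P j; have := t'P k; rewrite Ejk !in_itv /= => /andP[a1 a2] /andP[a3 a4].
  by rewrite ltNge ler_norml mulr2n => /negP[]; apply/andP; split; lra.
exists t' => //.
have sP : size P = n.+1.
  by rewrite /P size_prod_XsubC /index_enum -enumT size_enum_ord.
have sE : size (P - e *: N) = n.+1.
  rewrite size_polyDl ?sP // size_polyN ltnS (leq_trans _ sN) //.
  exact: size_scale_leq.
have := @all_roots_prod_XsubC _ (P - e *: N) [seq t' j | j <- enum 'I_n].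
rewrite size_map size_enum_ord sE => ->; rewrite ?big_map ?big_enum //=; last 2 first.
- by apply/allP => x /mapP[j _ ->].
- by rewrite uniq_rootsE map_inj_uniq ?enum_uniq.
suff -> : lead_coef (P - e *: N) = 1 by rewrite scale1r.
rewrite lead_coefDl; first by rewrite /P lead_coef_prod_XsubC.
by rewrite sP size_polyN ltnS (leq_trans _ sN) // size_scale_leq.
Qed.

(** * Conjugation on the circle and partial fractions *)

(** On the unit circle [x] times the conjugate of [x - z k] is [1 - x / z k], and multiplying by
    [- z k] gives back [x - z k]. *)
Lemma prod_conj_sub_circle (R : realType) (p : nat) (z : 'I_p -> R[i]) (x : R[i]) j :
  on_circle 0 1 z -> `|x| = 1 ->
  \prod_(k < p) - z k * \prod_(k < p | k != j) (x * (x - z k)^*) =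
  - z j * \prod_(k < p | k != j) (x - z k).
Proof.
move=> zc x1; rewrite (bigD1 j) //= -mulrA -big_split /=; congr (_ * _).
apply: eq_bigr => k _.
have xx : x * x^* = 1 by rewrite -normCK x1 expr1n.
have zz : z k * (z k)^* = 1 by rewrite -normCK -[z k]subr0 zc expr1n.
have -> : (x - z k)^* = x^* - (z k)^* by rewrite rmorphB.
ring: xx zz.
Qed.

(** The numerator of [\sum_j w_j / (X - t_j)] over the common denominator [\prod_k (X - t_k)]. It
    serves both for the foci (complex vertices) and for the pencil (real parameters). *)
Definition pfrac_num (K : nzRingType) (p : nat) (t w : 'I_p -> K) : {poly K} :=
  \sum_(j < p) w j *: \prod_(k < p | k != j) ('X - (t k)%:P).

Lemma prod_XsubC_predC1 (K : comNzRingType) (p : nat) (t : 'I_p -> K) j :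
  \prod_(k < p | k != j) ('X - (t k)%:P) =
  \prod_(x <- [seq t k | k <- enum (predC1 j)]) ('X - x%:P).
Proof. by rewrite big_map big_enum. Qed.

Lemma size_map_enum_predC1 (T : Type) (p : nat) (t : 'I_p -> T) j :
  size [seq t k | k <- enum (predC1 j)] = p.-1.
Proof. by rewrite size_map -cardE cardC1 card_ord. Qed.

Lemma size_pfrac_num (K : idomainType) (p : nat) (t w : 'I_p -> K) :
  (size (pfrac_num t w) <= p)%N.
Proof.
apply: (leq_trans (size_sum _ _ _)); apply/bigmax_leqP => j _.
apply: (leq_trans (size_scale_leq _ _)).
rewrite prod_XsubC_predC1 size_prod_XsubC size_map_enum_predC1.
by rewrite prednK // (leq_ltn_trans (leq0n j)).
Qed.

Lemma horner_pfrac_num (K : comNzRingType) (p : nat) (t w : 'I_p -> K) x :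
  (pfrac_num t w).[x] = \sum_(j < p) w j * \prod_(k < p | k != j) (x - t k).
Proof.
rewrite horner_sum; apply: eq_bigr => j _; rewrite hornerZ horner_prod.
by congr (_ * _); apply: eq_bigr => k _; rewrite hornerXsubC.
Qed.

Lemma pfrac_num_node (K : comNzRingType) (p : nat) (t w : 'I_p -> K) j :
  (pfrac_num t w).[t j] = w j * \prod_(k < p | k != j) (t j - t k).
Proof.
rewrite horner_pfrac_num (bigD1 j) //= [X in _ + X]big1 ?addr0 // => i ij.
by rewrite (bigD1 j) 1?eq_sym //= subrr mul0r mulr0.
Qed.

Lemma pfrac_num_lagrange (K : fieldType) (p : nat) (t : 'I_p -> K) (N : {poly K}) :
  injective t -> (size N <= p)%N ->
  N = pfrac_num t (fun j => N.[t j] / \prod_(k < p | k != j) (t j - t k)).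
Proof.
move=> tI sN; set w := fun j => _; apply/eqP; rewrite -subr_eq0.
apply: contraT => D0.
set D := N - _ in D0.
have sD : (size D <= p)%N.
  by rewrite (leq_trans (size_polyD _ _)) // geq_max sN size_polyN size_pfrac_num.
rewrite leqNgt in sD; case/negP: sD.
rewrite -[X in (X < _)%N](size_enum_ord p) -(size_map t).
apply: (max_poly_roots D0); last by rewrite map_inj_uniq ?enum_uniq.
apply/allP => x /mapP[j _ ->]; rewrite rootE hornerD hornerN pfrac_num_node.
rewrite /w divfK ?subrr //; apply/prodf_neq0 => k kj.
by rewrite subr_eq0 (inj_eq tI) eq_sym.
Qed.

(** In the [j]-th term the two products differ only by the factors [x - t j] and [y - t j], whose
    difference is [x - y]. *)
Lemma bezoutian_pfrac (K : comNzRingType) (p : nat) (t w : 'I_p -> K) (x y : K) :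
  let P := \prod_(k < p) ('X - (t k)%:P) in
  P.[x] * (pfrac_num t w).[y] - (pfrac_num t w).[x] * P.[y] =
  (x - y) * \sum_(j < p) w j * \prod_(k < p | k != j) ((x - t k) * (y - t k)).
Proof.
move=> P; rewrite !horner_pfrac_num mulr_sumr mulr_suml -sumrB mulr_sumr.
apply: eq_bigr => j _.
have PE u : P.[u] = (u - t j) * \prod_(k < p | k != j) (u - t k).
  rewrite horner_prod (bigD1 j) //= hornerXsubC; congr (_ * _).
  by apply: eq_bigr => k _; rewrite hornerXsubC.
by rewrite !PE big_split /=; ring.
Qed.

Lemma lead_coef_pfrac_num (K : idomainType) (p : nat) (t w : 'I_p -> K) :
  (pfrac_num t w)`_p.-1 = \sum_j w j.
Proof.
rewrite coef_sum; apply: eq_bigr => j _; rewrite coefZ prod_XsubC_predC1.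
set s := [seq _ | _ <- _].
have <- : size s = p.-1 by exact: size_map_enum_predC1.
have := lead_coef_prod_XsubC s predT id.
by rewrite lead_coefE size_prod_XsubC => ->; rewrite mulr1.
Qed.

Lemma subleading_coef_pfrac_num (K : idomainType) (p : nat) (t w : 'I_p -> K) :
  (1 < p)%N -> (pfrac_num t w)`_p.-2 =
    \sum_j w j * t j - (\sum_j w j) * \sum_j t j.
Proof.
move=> p1; rewrite coef_sum mulr_suml -sumrB; apply: eq_bigr => j _.
rewrite coefZ prod_XsubC_predC1; set s := [seq _ | _ <- _].
have sE : size s = p.-1 by exact: size_map_enum_predC1.
rewrite -sE coefPn_prod_XsubC ?sE; last by case: p p1 {t w j s sE} => [|[]].
rewrite /s big_map (bigD1 j) //= big_enum /=; ring.
Qed.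

(** * Foci, vertex sum and vertex product *)

Local Notation toC := (fun w j => (w j)%:C%C).

(** Both polynomials are multiples of the focal polynomial, and the leading coefficients fix the
    factor. Since there are exactly [p.-1] foci, the sum of the weights comes out nonzero. *)
Lemma real_foci_numerator (R : realType) (p : nat) (C : {mpoly R[3]})
    (a : (p.-1).-tuple R[i]) (z : 'I_p -> R[i]) (m : 'I_p -> R) :
  real_foci C a -> same_curve C (siebeck_marden_form z m) ->
  \sum_j m j != 0 /\
  pfrac_num z (toC m) = (\sum_j m j)%:C%C *: \prod_(x <- a) ('X - x%:P).
Proof.
case=> d d0 fE [c c0 CE].
have c0' : c%:C%C * (-1) ^+ p.-1 != 0 :> R[i].
  by rewrite mulf_neq0 ?signr_eq0 // (fmorph_eq0 (real_complex R)).
have E : pfrac_num z (toC m) =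
    (d / (c%:C%C * (-1) ^+ p.-1)) *: \prod_(x <- a) ('X - x%:P).
  apply: (scalerI c0'); rewrite scalerA [X in _ = X *: _]mulrC divfK // -fE CE.
  by rewrite /focal_poly mmapZ /= mul_polyC -scalerA -focal_poly_siebeck_marden.
have := lead_coef_pfrac_num z (toC m); rewrite E coefZ.
have := lead_coef_prod_XsubC a predT id.
rewrite lead_coefE size_prod_XsubC size_tuple => ->; rewrite mulr1.
rewrite -(rmorph_sum (real_complex R)) /= => dE; rewrite dE; split => //.
rewrite -(fmorph_eq0 (real_complex R)) /= -dE mulf_neq0 ?invr_eq0 //.
Qed.

(** The weighted sum [\sum_j m_j z_j] appears in the subleading coefficient of [f = M g] and,
    through conjugation, in [f(0)]. Eliminating it leaves the plain sum of the vertices. *)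
Lemma vertex_sum (R : realType) (p : nat) (C : {mpoly R[3]})
    (a : (p.-1).-tuple R[i]) (z : 'I_p -> R[i]) :
  (1 < p)%N -> real_foci C a -> poncelet_family C z ->
  \sum_k z k = \sum_(x <- a) x - (\prod_k - z k) * (\prod_(x <- a) - x)^*.
Proof.
move=> p1 ha [zI zc [m _ /(real_foci_numerator ha) [M0]]].
set M := \sum_j m j; set g := \prod_(x <- a) _; set f := pfrac_num _ _ => fE.
have MC0 : M%:C%C != 0 :> R[i] by rewrite (fmorph_eq0 (real_complex R)).
have g1 : g`_p.-2 = - \sum_(x <- a) x.
  have := @coefPn_prod_XsubC _ a; rewrite size_tuple => -> //.
  by case: p p1 {C a ha z zI zc m M0 M g f fE MC0} => [|[]].
have f1 : f`_p.-2 = \sum_j (m j)%:C%C * z j - M%:C%C * \sum_j z j.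
  by rewrite subleading_coef_pfrac_num //= (rmorph_sum (real_complex R)).
have g0 : g.[0] = \prod_(x <- a) - x.
  by rewrite horner_prod; apply: eq_bigr => x _; rewrite hornerXsubC sub0r.
have f0 : (\prod_k - z k) * f.[0]^* = - \sum_j (m j)%:C%C * z j.
  rewrite horner_pfrac_num rmorph_sum mulr_sumr -sumrN; apply: eq_bigr => j _.
  rewrite rmorphM rmorph_prod (bigD1 j) //=.
  have -> : ((m j)%:C%C)^* = (m j)%:C%C :> R[i].
    by apply: conjc_real.
  rewrite mulrACA [X in _ * X](_ : _ = 1) ?mulr1 1?mulrC ?mulrN //.
  rewrite -big_split big1 //= => k _.
  by rewrite sub0r mulrC -normCK normrN -[z k]subr0 zc expr1n.
move: f1 f0; rewrite fE coefZ hornerZ g1 g0 rmorphM /=.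
have -> : (M%:C%C)^* = M%:C%C :> R[i] by apply: conjc_real.
move=> f1 f0; apply: (mulfI MC0); rewrite mulrBr mulrCA f0.
by rewrite -[M%:C%C * \sum_(x <- a) x]opprK -mulrN f1; ring.
Qed.

(** By [circleE], the foci and the product of the [- y k] determine [\prod_k (x - y k)] on the
    circle; with equal products, the one for [z'] vanishes at [z j]. *)
Lemma eq_prod_shared_vertex (R : realType) (p : nat) (C : {mpoly R[3]})
    (a : (p.-1).-tuple R[i]) (z z' : 'I_p -> R[i]) j :
  real_foci C a -> poncelet_family C z -> poncelet_family C z' ->
  \prod_k - z k = \prod_k - z' k -> exists k, z j = z' k.
Proof.
move=> ha hz hz' mu_eq.
suff circleE (y : 'I_p -> R[i]) x : poncelet_family C y -> `|x| = 1 ->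
    \prod_k (x - y k) = x * (\prod_(u <- a) ('X - u%:P)).[x] +
     (\prod_k - y k) * (x ^+ p.-1 * (\prod_(u <- a) ('X - u%:P)).[x]^*).
  have zj1 : `|z j| = 1 by case: hz => _ /(_ j); rewrite subr0.
  have := circleE z _ hz zj1; rewrite mu_eq -(circleE z' _ hz' zj1).
  rewrite (bigD1 j) //= subrr mul0r => /esym/eqP/prodf_eq0[k _].
  by rewrite subr_eq0 => /eqP; exists k.
case=> yI yc [m _ /(real_foci_numerator ha)[M0]] fE x1.
set M := \sum_j m j in M0 fE.
have MC0 : M%:C%C != 0 :> R[i] by rewrite (fmorph_eq0 (real_complex R)).
apply: (mulfI MC0); rewrite mulrDr mulrCA -hornerZ -fE.
have -> : M%:C%C * (\prod_k - y k *
   (x ^+ p.-1 * (\prod_(u <- a) ('X - u%:P)).[x]^*)) =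
   \prod_k - y k * (x ^+ p.-1 * (pfrac_num y (toC m)).[x]^*).
  rewrite fE hornerZ rmorphM /= (_ : (M%:C%C)^* = M%:C%C :> R[i]); first by ring.
  exact: conjc_real.
rewrite horner_pfrac_num [(\sum_(i < p) _)^*]rmorph_sum !mulr_sumr -big_split /=.
rewrite (rmorph_sum (real_complex R)) mulr_suml; apply: eq_bigr => i _.
have -> : x ^+ p.-1 = \prod_(k < p | k != i) x.
  by rewrite prodr_const (@eq_card _ _ (predC1 i)) // cardC1 card_ord.
rewrite rmorphM rmorph_prod /= [_%:C%C^*]conjc_real.
(* The factor [x] of the first summand and the factor [- y i] produced by conjugation add up to the
   missing factor [x - y i]. *)
have := prod_conj_sub_circle i yc x1; rewrite big_split /=.
set A := \prod_k - y k; set B := \prod_(k < p | _) x; set D := \prod_(k < p | _) _^*.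
rewrite [\prod_(k < p) (x - y k)](bigD1 i) //=.
set E := \prod_(k < p | k != i) (x - y k) => ABD.
rewrite (_ : A * (B * _) = (m i)%:C%C * (A * (B * D))); last by ring.
by rewrite ABD; ring.
Qed.

(** * Invariance of the Bezoutian along the pencil *)

Lemma quadratic_split (K : numClosedFieldType) (a b c : K) :
  a != 0 -> b ^+ 2 - 4 * a * c != 0 ->
  exists x y, x != y /\ forall t, a * t ^+ 2 + b * t + c = a * ((x - t) * (y - t)).
Proof.
move=> a0; set D := _ - _; set s := sqrtC D => D0.
have s0 : s != 0 by rewrite sqrtC_eq0.
have sE : s ^+ 2 = D by rewrite sqrtCK.
have n2 : 2 != 0 :> K by rewrite pnatr_eq0.
exists ((- b + s) / (2 * a)), ((- b - s) / (2 * a)); split.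
  rewrite -subr_eq0 [X in X != 0](_ : _ = s / a); last by field; rewrite ?n2 ?a0.
  by rewrite mulf_neq0 ?invr_eq0.
move=> t; apply/eqP; rewrite -subr_eq0.
rewrite [X in X == 0](_ : _ = (s ^+ 2 - D) / (4 * a)); first by rewrite sE subrr mul0r.
by rewrite /D; field; rewrite ?a0 ?n2 ?pnatr_eq0.
Qed.

(* For nodes [t] the form [\sum_j w_j \prod_(k != j) q(t_k)], with [q] a
   quadratic polynomial with roots [x] and [y], is a multiple of the Bezoutian
   [(P(x) N(y) - N(x) P(y)) / (x - y)], which does not change when [P] is
   replaced by [P - e N]. *)
Lemma pencil_sum_invariant_closed (K : numClosedFieldType) (p : nat)
    (t w t' w' : 'I_p -> K) (e a b c : K) :
  \prod_(k < p) ('X - (t k)%:P) - e *: pfrac_num t w =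
    \prod_(k < p) ('X - (t' k)%:P) ->
  pfrac_num t w = pfrac_num t' w' ->
  a != 0 -> b ^+ 2 - 4 * a * c != 0 ->
  \sum_(j < p) w j * \prod_(k < p | k != j) (a * t k ^+ 2 + b * t k + c) =
  \sum_(j < p) w' j * \prod_(k < p | k != j) (a * t' k ^+ 2 + b * t' k + c).
Proof.
move=> EP EN a0 D0; have [x [y [xy qE]]] := quadratic_split a0 D0.
have sumE (u v : 'I_p -> K) :
    \sum_(j < p) v j * \prod_(k < p | k != j) (a * u k ^+ 2 + b * u k + c) =
    a ^+ p.-1 * \sum_(j < p) v j * \prod_(k < p | k != j) ((x - u k) * (y - u k)).
  rewrite mulr_sumr; apply: eq_bigr => j _; rewrite mulrCA; congr (_ * _).
  rewrite -[p.-1]card_ord -(_ : #|predC1 j| = #|'I_p.-1|); last first.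
    by rewrite cardC1 !card_ord.
  by rewrite -prodr_const -big_split; apply: eq_bigr => k _; rewrite qE.
rewrite !sumE; congr (_ * _).
(* Distinct roots allow the factor [x - y] of the Bezoutian to be cancelled. *)
have xy0 : x - y != 0 by rewrite subr_eq0.
apply: (mulfI xy0); rewrite -!bezoutian_pfrac -EP -EN !hornerE; ring.
Qed.

(** The real quadratic may have nonreal roots, so the identity is proved in [R[i]] and pulled back
    along the injective embedding. *)
Lemma pencil_sum_invariant (R : rcfType) (p : nat)
    (t w t' w' : 'I_p -> R) (e a b c : R) :
  \prod_(k < p) ('X - (t k)%:P) - e *: pfrac_num t w =
    \prod_(k < p) ('X - (t' k)%:P) ->
  pfrac_num t w = pfrac_num t' w' ->
  a != 0 -> b ^+ 2 - 4 * a * c != 0 ->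
  \sum_(j < p) w j * \prod_(k < p | k != j) (a * t k ^+ 2 + b * t k + c) =
  \sum_(j < p) w' j * \prod_(k < p | k != j) (a * t' k ^+ 2 + b * t' k + c).
Proof.
move=> EP EN a0 D0; pose f : {rmorphism R -> R[i]} := real_complex R.
have mapP (u : 'I_p -> R) : map_poly f (\prod_(k < p) ('X - (u k)%:P)) =
    \prod_(k < p) ('X - (f (u k))%:P).
  by rewrite rmorph_prod; apply: eq_bigr => k _; rewrite rmorphB /= map_polyX map_polyC.
have mapN (u v : 'I_p -> R) :
    map_poly f (pfrac_num u v) = pfrac_num (f \o u) (f \o v).
  rewrite rmorph_sum; apply: eq_bigr => j _; rewrite /= map_polyZ rmorph_prod.
  by congr (_ *: _); apply: eq_bigr => k _; rewrite rmorphB /= map_polyX map_polyC.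
have mapS (u v : 'I_p -> R) :
    f (\sum_(j < p) v j * \prod_(k < p | k != j) (a * u k ^+ 2 + b * u k + c)) =
    \sum_(j < p) (f \o v) j * \prod_(k < p | k != j)
      (f a * (f \o u) k ^+ 2 + f b * (f \o u) k + f c).
  rewrite rmorph_sum; apply: eq_bigr => j _; rewrite rmorphM rmorph_prod.
  congr (_ * _); apply: eq_bigr => k _.
  by rewrite !(rmorphD, rmorphM, rmorphXn).
apply: (fmorph_inj f); rewrite !mapS.
apply: (@pencil_sum_invariant_closed _ _ _ _ _ _ (f e)).
- by rewrite -mapN -!mapP -EP rmorphB /= map_polyZ.
- by rewrite -!mapN EN.
- by rewrite fmorph_eq0.
by rewrite -rmorphXn -(rmorph_nat f) -!rmorphM -rmorphB fmorph_eq0.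
Qed.

(** * Rational parametrization of the circle *)

(** The form of the point [o * circle_param t] multiplied by [t ^+ 2 + 1], arranged as a quadratic
    polynomial in [t]. *)
Definition quad_form (R : realType) (o : R[i]) (t : R) : {mpoly R[3]} :=
  t ^+ 2 *: point_form o +
  t *: (2 *: (complex.Re o *: 'X_1 - complex.Im o *: 'X_0)) +
  point_form (- o).

(** The Cayley transform [(t + i) / (t - i)]. It misses only the point 1; its inverse is
    [t = y / (1 - x)]. *)
Definition circle_param (R : realType) (t : R) : R[i] :=
  ((t ^+ 2 - 1) / (t ^+ 2 + 1) +i* (2 * t / (t ^+ 2 + 1)))%C.

Lemma sqr_add1_neq0 (R : realDomainType) (t : R) : t ^+ 2 + 1 != 0.
Proof. by rewrite gt_eqF // ltr_wpDl ?sqr_ge0. Qed.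

Lemma circle_param_inj (R : realType) : injective (@circle_param R).
Proof.
have K (t : R) : complex.Im (circle_param t) / (1 - complex.Re (circle_param t)) = t.
  have h := sqr_add1_neq0 t; have n2 : 2 != 0 :> R by rewrite pnatr_eq0.
  have E : 1 - (t ^+ 2 - 1) / (t ^+ 2 + 1) = 2 / (t ^+ 2 + 1) by field.
  by rewrite [LHS]/= E invf_div mulrA divfK // mulrAC divff // mul1r.
by move=> t t' E; rewrite -[t]K E K.
Qed.

Lemma norm_circle_param (R : realType) (t : R) : `|circle_param t| = 1.
Proof.
rewrite normc_def /= (_ : _ + _ = 1) ?sqrtr1 //.
by field; rewrite sqr_add1_neq0.
Qed.

Lemma circle_param_onto (R : realType) (u : R[i]) :
  `|u| = 1 -> u != 1 -> exists t, u = circle_param t.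
Proof.
case: u => x y u1 n1.
have xy : x ^+ 2 + y ^+ 2 = 1.
  apply: complexI; rewrite (_ : x ^+ 2 + y ^+ 2 =
    complex.Re (x +i* y)%C ^+ 2 + complex.Im (x +i* y)%C ^+ 2) //.
  by rewrite add_Re2_Im2 u1 expr1n.
have x1 : 1 - x != 0.
  apply: contra n1; rewrite subr_eq0 => /eqP xE.
  move: xy; rewrite -xE expr1n => /eqP; rewrite -subr_eq0 addrC addKr sqrf_eq0.
  by move/eqP ->.
exists (y / (1 - x)).
have yE : y ^+ 2 = (1 - x) * (1 + x) by rewrite -[y ^+ 2](addKr (x ^+ 2)) xy; ring.
have h : (y / (1 - x)) ^+ 2 + 1 = 2 / (1 - x).
  by rewrite expr_div_n yE; field.
have h' : (y / (1 - x)) ^+ 2 - 1 = 2 * x / (1 - x).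
  by rewrite expr_div_n yE; field.
rewrite /circle_param h h'; congr Complex; field; rewrite ?x1 ?pnatr_eq0 //.
Qed.

Lemma point_form_param (R : realType) (o : R[i]) (t : R) :
  point_form (o * circle_param t) = (t ^+ 2 + 1)^-1 *: quad_form o t.
Proof.
have h := sqr_add1_neq0 t.
apply: (scalerI h); rewrite scalerA divff // scale1r.
have Eu : (t ^+ 2 + 1) * ((t ^+ 2 - 1) / (t ^+ 2 + 1)) = t ^+ 2 - 1.
  by rewrite mulrC divfK.
have Ev : (t ^+ 2 + 1) * (2 * t / (t ^+ 2 + 1)) = 2 * t by rewrite mulrC divfK.
rewrite /quad_form /point_form /circle_param; case: o => x y /=.
move: Eu Ev; move: (_ / _) (_ / _) => u v.
move=> /(congr1 (@mpolyC 3 R)) Eu /(congr1 (@mpolyC 3 R)) Ev.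
rewrite -!mul_mpolyC; move: Eu Ev.
rewrite !(rmorphD, rmorphB, rmorphN, rmorphM, rmorphXn, rmorph_nat, rmorph1) /= => Eu Ev.
move: Eu Ev; move: t%:MP u%:MP v%:MP x%:MP y%:MP => T U V X Y EV EU.
transitivity ((T * T + 1) * V * (X * 'X_0 + Y * 'X_1) +
  (T * T + 1) * U * (X * 'X_1 - Y * 'X_0) + (T * T + 1) * 'X_2); first by ring.
by rewrite EU EV; ring.
Qed.

(** The numerical identity applies at each [v] where the leading coefficient [a] and the
    discriminant do not vanish. Multiplying by [h], their product, makes it hold at every [v]; the
    nonzero polynomial [h] is then cancelled. *)
Lemma pencil_form_invariant (R : realType) (p : nat) (o : R[i])
    (t w t' w' : 'I_p -> R) (e : R) :
  \prod_(k < p) ('X - (t k)%:P) - e *: pfrac_num t w =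
    \prod_(k < p) ('X - (t' k)%:P) ->
  pfrac_num t w = pfrac_num t' w' ->
  \sum_(j < p) w j *: \prod_(k < p | k != j) quad_form o (t k) =
  \sum_(j < p) w' j *: \prod_(k < p | k != j) quad_form o (t' k).
Proof.
move=> EP EN.
pose a := point_form o; pose c := point_form (- o).
pose b : {mpoly R[3]} := 2 *: (complex.Re o *: 'X_1 - complex.Im o *: 'X_0).
pose h := a * (b ^+ 2 - 4 *: (a * c)).
have quadE v t0 : (quad_form o t0).@[v] = a.@[v] * t0 ^+ 2 + b.@[v] * t0 + c.@[v].
  rewrite /quad_form -/a -/b -/c [(_ + c).@[v]]mevalD [(_ *: a + _).@[v]]mevalD.
  rewrite [(_ *: a).@[v]]mevalZ [(_ *: b).@[v]]mevalZ.
  by ring.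
have pointE v y : (point_form y).@[v] =
    complex.Re y * v 0 + complex.Im y * v 1 + v 2.
  by rewrite /point_form !mevalD !mevalZ !mevalXU.
have hE v : h.@[v] = a.@[v] * (b.@[v] ^+ 2 - 4 * a.@[v] * c.@[v]).
  by rewrite mevalM mevalB mevalZ rmorphXn mevalM mulrA.
have h0 : h != 0.
  (* At [v = (0, 0, 1)] one has [a = c = 1] and [b = 0], so [h] takes the value [-4]. *)
  apply/eqP => /(congr1 (meval (fun i => (i == 2)%:R))).
  rewrite meval0 hE !pointE mevalZ mevalB !mevalZ !mevalXU !eqxx /=.
  rewrite !mulr0 !add0r oppr0 mulr0 expr0n /= ?add0r ?sub0r mul1r !mulr1.
  by move/eqP; rewrite oppr_eq0 pnatr_eq0.
apply: (mulfI h0); apply/eqP; rewrite -subr_eq0; apply/eqP.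
apply: meval_eq0_mpoly => v; rewrite mevalB ![(h * _).@[v]]mevalM -mulrBr hE.
have [->|a0] := eqVneq a.@[v] 0; first by rewrite !mul0r.
have [->|D0] := eqVneq (b.@[v] ^+ 2 - 4 * a.@[v] * c.@[v]) 0.
  by rewrite mulr0 mul0r.
have sumE (u y : 'I_p -> R) :
    (\sum_(j < p) y j *: \prod_(k < p | k != j) quad_form o (u k)).@[v] =
    \sum_(j < p) y j * \prod_(k < p | k != j)
      (a.@[v] * u k ^+ 2 + b.@[v] * u k + c.@[v]).
  rewrite raddf_sum; apply: eq_bigr => j _; rewrite /= mevalZ (rmorph_prod (meval v)).
  by congr (_ * _); apply: eq_bigr => k _; rewrite -quadE.
by rewrite !sumE (pencil_sum_invariant EP EN a0 D0) subrr mulr0.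
Qed.

(** The [j]-th product lacks the denominator of the vertex [j], which therefore moves into the
    weight. *)
Lemma siebeck_marden_form_param (R : realType) (p : nat) (o : R[i])
    (t m : 'I_p -> R) :
  siebeck_marden_form (fun j => o * circle_param (t j)) m =
  (\prod_k (t k ^+ 2 + 1))^-1 *:
    \sum_(j < p) (m j * (t j ^+ 2 + 1)) *: \prod_(k < p | k != j) quad_form o (t k).
Proof.
rewrite /siebeck_marden_form scaler_sumr; apply: eq_bigr => j _ /=.
under eq_bigr => k _ do rewrite point_form_param.
rewrite scaler_prod !scalerA; congr (_ *: _).
rewrite [\prod_k (t k ^+ 2 + 1)](bigD1 j) //= invfM prodfV.
by rewrite [RHS]mulrC -mulrA mulVKf ?sqr_add1_neq0.
Qed.

(** * Further polygons of the family *)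

Lemma pfrac_num_no_common_root (K : fieldType) (p : nat) (t w : 'I_p -> K) x :
  injective t -> (forall j, w j != 0) ->
  (\prod_(k < p) ('X - (t k)%:P)).[x] = 0 -> (pfrac_num t w).[x] != 0.
Proof.
move=> tI w0 /eqP; rewrite horner_prod => /prodf_eq0[j _].
rewrite hornerXsubC subr_eq0 => /eqP ->; rewrite pfrac_num_node mulf_neq0 //.
by apply/prodf_neq0 => k kj; rewrite subr_eq0 (inj_eq tI) eq_sym.
Qed.

(** Supplies a rotation that moves the point missed by [circle_param] away from all vertices: among
    [p.+1] points of the circle one is not a vertex. *)
Lemma exists_unit_not_vertex (R : realType) (p : nat) (z : 'I_p -> R[i]) :
  exists2 o : R[i], `|o| = 1 & forall j, z j != o.
Proof.
pose s := [seq circle_param (k%:R : R) | k <- iota 0 p.+1].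
have us : uniq s.
  rewrite map_inj_uniq ?iota_uniq // => i j /circle_param_inj /eqP.
  by rewrite eqr_nat => /eqP.
have /allPn[o os oz] : ~~ all (mem [seq z j | j <- enum 'I_p]) s.
  apply/negP => /allP sz.
  have := @uniq_leq_size _ s [seq z j | j <- enum 'I_p] us sz.
  by rewrite (size_map z) size_map size_iota size_enum_ord ltnn.
exists o; first by case/mapP: os => k _ ->; rewrite norm_circle_param.
by move=> j; apply: contra oz => /eqP <-; rewrite inE map_f ?mem_enum.
Qed.

(** A parameter shared by two members of the pencil satisfies [P = e N = e' N] there with [N]
    nonzero, which forces [e = e']. *)
Lemma disjoint_poncelet_polygons (R : realType) (p : nat) (C : {mpoly R[3]})
    (a : (p.-1).-tuple R[i]) (z : 'I_p -> R[i]) (n : nat) :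
  real_foci C a -> poncelet_family C z ->
  exists2 Z : 'I_n -> 'I_p -> R[i], (forall i, poncelet_family C (Z i)) &
    forall i i' j k, Z i j = Z i' k -> i = i'.
Proof.
move=> ha [zI zc [m [m0 _] hC]].
have [o o1 oz] := exists_unit_not_vertex z.
have o0 : o != 0 by rewrite -normr_eq0 o1 oner_eq0.
have /fin_all_exists[t tE] j : exists t, z j = o * circle_param t.
  have [||t tE] := @circle_param_onto R (z j / o).
  - by rewrite normf_div o1 divr1 -[z j]subr0 zc.
  - by apply: contra (oz j) => /eqP E; rewrite -[z j](divfK o0) E mul1r.
  by exists t; rewrite -tE mulrC divfK.
have tI : injective t by move=> j k E; apply: zI; rewrite !tE E.
pose w j := m j * (t j ^+ 2 + 1).
have w0 j : w j != 0 by rewrite mulf_neq0 ?sqr_add1_neq0.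
pose P := \prod_(k < p) ('X - (t k)%:P); pose N := pfrac_num t w.
have sN : (size N <= p)%N by exact: size_pfrac_num.
have [d d0 dP] := simple_real_roots_perturb tI sN.
(* The shift by 2 keeps [e i] strictly below [d] even for [i = 0]. *)
pose e (i : 'I_n) := d / i.+2%:R.
have eI : injective e.
  move=> i i' /(mulfI (lt0r_neq0 d0)) /invr_inj /eqP.
  by rewrite eqr_nat => /eqP[] /val_inj.
have /fin_all_exists2[T TI TE] (i : 'I_n) : exists2 t' : 'I_p -> R,
    injective t' & P - e i *: N = \prod_(k < p) ('X - (t' k)%:P).
  apply: dP; rewrite ger0_norm ?divr_ge0 ?ltW //.
  by rewrite gtr_pMr // invf_lt1 ?ltr0n // ltr1n.
have NT i j : N.[T i j] != 0.
  apply/eqP => N0; have P0 : P.[T i j] = 0.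
    have := congr1 (horner^~ (T i j)) (TE i).
    rewrite !hornerE /= N0 mulr0 subr0 => ->.
    by rewrite horner_prod (bigD1 j) //= hornerXsubC subrr mul0r.
  by have := pfrac_num_no_common_root tI w0 P0; rewrite -/N N0 eqxx.
exists (fun i j => o * circle_param (T i j)) => [i|i i' j k]; last first.
  move=> /(mulfI o0) /circle_param_inj E; apply: eI.
  have E0 i0 j0 : P.[T i0 j0] = e i0 * N.[T i0 j0].
    apply/eqP; rewrite -subr_eq0; have := congr1 (horner^~ (T i0 j0)) (TE i0).
    rewrite !hornerE /= => ->.
    by rewrite horner_prod (bigD1 j0) //= hornerXsubC subrr mul0r.
  by apply: (mulIf (NT i j)); rewrite -E0 E E0.
(* The residues of [N / (P - e N)] at its poles; dividing by [t ^+ 2 + 1] turns them into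
   weights. *)
pose v j := N.[T i j] / \prod_(k < p | k != j) (T i j - T i k).
have Nv : N = pfrac_num (T i) v by exact: pfrac_num_lagrange.
pose m' j := v j / (T i j ^+ 2 + 1).
have m'0 j : m' j != 0.
  rewrite !mulf_neq0 ?invr_eq0 ?sqr_add1_neq0 //.
  by apply/prodf_neq0 => k kj; rewrite subr_eq0 (inj_eq (TI i)) eq_sym.
have hC' : same_curve C
    (siebeck_marden_form (fun j => o * circle_param (T i j)) m').
  case: hC => c c0 ->.
  pose q (u : 'I_p -> R) := \prod_k (u k ^+ 2 + 1).
  have q0 u : q u != 0 by apply/prodf_neq0 => k _; exact: sqr_add1_neq0.
  exists (c * (q t)^-1 * q (T i)); first by rewrite !mulf_neq0 ?invr_eq0.
  rewrite siebeck_marden_form_param -/(q _) [in RHS]scalerA mulfK //.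
  under [in RHS]eq_bigr => j _ do rewrite /m' divfK ?sqr_add1_neq0 //.
  rewrite -(pencil_form_invariant o (TE i) Nv) -scalerA; congr (_ *: _).
  rewrite -siebeck_marden_form_param; apply: eq_bigr => j _.
  by congr (_ *: _); apply: eq_bigr => k _; rewrite tE.
(* The curve [C] and its foci are unchanged, so the new weights have nonzero sum. *)
have [M0 _] := real_foci_numerator ha hC'.
split; last by exists m'.
- by move=> j k /(mulfI o0) /circle_param_inj /TI.
- by move=> j; rewrite subr0 normrM o1 norm_circle_param mulr1.
Qed.

(** * Squared lengths and the equivalence *)

(** Summing [2 - 2 Re (z_j / z_k)], the squared distance, over all ordered pairs counts each segment
    twice and gives [2 p^2 - 2 |\sum_j z_j|^2]. *)
Lemma sum_sq_lengths_circle (R : realType) (p : nat) (z : 'I_p -> R[i]) :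
  on_circle 0 1 z ->
  sum_sq_lengths z = p%:R ^+ 2 - `|\sum_j z j| ^+ 2.
Proof.
move=> zc; have n2 : 2 != 0 :> R[i] by rewrite pnatr_eq0.
apply: (mulfI n2).
have -> : 2 * sum_sq_lengths z = \sum_j \sum_k `|z j - z k| ^+ 2.
  have swap : sum_sq_lengths z =
      \sum_(j < p) \sum_(k < p | (k < j)%N) `|z j - z k| ^+ 2.
    rewrite /sum_sq_lengths (exchange_big_dep predT) //=.
    by apply: eq_bigr => j _; apply: eq_bigr => k _; rewrite distrC.
  rewrite mulr_natl mulr2n [X in X + _]swap -big_split; apply: eq_bigr => j _ /=.
  rewrite [RHS](bigD1 j) //= subrr normr0 expr0n add0r.
  rewrite (bigID (fun k : 'I_p => (k < j)%N) (fun k => k != j)) /=.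
  congr (_ + _); apply: eq_bigl => k.
    by rewrite -val_eqE /=; case: ltngtP.
  by rewrite -val_eqE /=; case: ltngtP.
have nz j : z j * (z j)^* = 1 by rewrite -normCK -[z j]subr0 zc expr1n.
transitivity (\sum_(j < p) \sum_(k < p) (2 - (z j * (z k)^* + (z j)^* * z k))).
  apply: eq_bigr => j _; apply: eq_bigr => k _; rewrite normCK rmorphB.
  by have := nz j; have := nz k => h h'; ring: h h'.
set S := \sum_j z j.
have inner j : \sum_(k < p) (2 - (z j * (z k)^* + (z j)^* * z k)) =
    2 *+ p - (z j * S^* + (z j)^* * S).
  rewrite sumrB sumr_const card_ord; congr (_ - _).
  by rewrite big_split /= -!mulr_sumr rmorph_sum.
under eq_bigr => j _ do rewrite inner.
rewrite sumrB sumr_const card_ord normCK.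
have -> : \sum_j (z j * S^* + (z j)^* * S) = S * S^* * 2.
  rewrite big_split /= -!mulr_suml -rmorph_sum -/S; ring.
by rewrite -[_ *+ p *+ p]mulr_natl -[_ *+ p]mulr_natl; ring.
Qed.

Unset Implicit Arguments.
Set Strict Implicit.
Set Printing Implicit Defensive.

Theorem theorem4p1 (R : realType) (p : nat) (hp : (3 <= p)%N)
    (C : {mpoly R[3]}) (hC : siebeck_marden_curve p C)
    (a : (p.-1).-tuple R[i]) (ha : real_foci C a)
    (hP : exists z : 'I_p -> R[i], poncelet_family C z) :
  (forall z z' : 'I_p -> R[i], poncelet_family C z -> poncelet_family C z' ->
     sum_sq_lengths z = sum_sq_lengths z')
  <-> (0 \in a \/ 0 = centroid a).
Proof.
(* The vertex sum is [A - mu k] with [|mu| = 1]; [A = 0] means that the centroid is 0, and [k = 0]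
   that 0 is a focus. *)
pose A := \sum_(x <- a) x; pose k := (\prod_(x <- a) - x)^*.
have p1 : (1 < p)%N by apply: leq_trans hp.
have centroidE : (0 = centroid a) <-> (A = 0).
  rewrite /centroid -/A; split=> [/esym/eqP|->]; last by rewrite mulr0.
  rewrite mulf_eq0 invr_eq0 pnatr_eq0 => /orP[|/eqP //].
  by rewrite -subn1 subn_eq0 leqNgt p1.
have fociE : (0 \in a) = (k == 0).
  rewrite conjC_eq0 prodf_seq_eq0 /=; apply/idP/hasP => [a0|[x xa]].
    by exists 0; rewrite // oppr0.
  by rewrite oppr_eq0 => /eqP <-.
have sumE (z : 'I_p -> R[i]) : poncelet_family C z -> sum_sq_lengths z =
    p%:R ^+ 2 - `|A - (\prod_j - z j) * k| ^+ 2.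
  move=> hz; rewrite -(vertex_sum p1 ha hz) sum_sq_lengths_circle //.
  by case: hz.
have norm_mu (z : 'I_p -> R[i]) : poncelet_family C z -> `|\prod_j - z j| = 1.
  case=> _ zc _; rewrite normr_prod big1 // => j _.
  by rewrite normrN -[z j]subr0 zc.
split=> [inv|deg z z' hz hz']; last first.
  rewrite !sumE //; case: deg => [|/centroidE ->].
    by rewrite fociE => /eqP ->; rewrite !mulr0.
  by rewrite !sub0r !normrN !normrM !norm_mu.
case: hP => z hz; have [Z ZC Zdisj] := disjoint_poncelet_polygons 3 ha hz.
pose mu i := \prod_j - Z i j.
have mumu i : mu i * (mu i)^* = 1 by rewrite -normCK norm_mu ?expr1n.
have mu0 i : mu i != 0 by rewrite -normr_eq0 norm_mu ?oner_eq0.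
have muI i i' : i != i' -> mu i - mu i' != 0.
  apply: contra; rewrite subr_eq0 => /eqP E.
  have [l El] := eq_prod_shared_vertex (Ordinal (ltnW p1)) ha (ZC i) (ZC i') E.
  by apply/eqP; apply: Zdisj El.
(* Expanding [|A - mu k|^2 = |A - mu' k|^2], with inverses in place of the conjugates of [mu] and
   [mu'], leaves a factor [mu - mu'] to cancel. *)
have crossE i i' : i != i' -> A^* * k * (mu i * mu i') = A * k^*.
  move=> /muI d0; have := inv _ _ (ZC i) (ZC i'); rewrite !sumE // -/(mu i) -/(mu i').
  move/addrI/oppr_inj; rewrite !normCK !rmorphB !rmorphM => E.
  apply: (mulIf d0); apply/eqP; rewrite -subr_eq0; apply/eqP.
  have := mumu i; have := mumu i'; move: E.
  set c := (mu i)^*; set c' := (mu i')^* => E E1 E2.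
  have E3 : A^* * k * mu i + A * k^* * c = A^* * k * mu i' + A * k^* * c'.
    apply: (addrI (- (A * A^* + k * k^*))).
    transitivity (- ((A - mu i * k) * (A^* - c * k^*))); first by ring: E2.
    by rewrite E; ring: E1.
  transitivity ((A^* * k * mu i + A * k^* * c - (A^* * k * mu i' + A * k^* * c')) *
     (mu i * mu i')); last by rewrite E3 subrr mul0r.
  by ring: E1 E2.
(* Two of these relations share the same right side; subtracting them gives
   [A^* k mu_0 (mu_1 - mu_2) = 0], hence [A = 0] or [k = 0]. *)
have /eqP := etrans (crossE 0 1 isT) (esym (crossE 0 2 isT)).
rewrite -subr_eq0 -!mulrBr !mulf_eq0 (negPf (mu0 _)) (negPf (muI 1 2 isT)) !orbF.
rewrite conjC_eq0 => /orP[/eqP/centroidE|k0]; first by right.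
by left; rewrite fociE.
Qed.
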